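(* Let $k\ge2$ and $m_1,\dots,m_k\in\mathbb{Z}$, and put $m=|m_1|+\dots+|m_k|$. For every $n\ge0$, the number $c_n(R,m_1,\dots,m_k)$ of walks of length $n$ in $R$ from $0$ coming successively through $m_1,\ m_1+m_2,\ \dots,\ m_1+\dots+m_{k-1}$ to $m_1+\dots+m_k$ satisfies $$c_n(R,m_1,\dots,m_k)=c_n(R,m)=\begin{cases}\binom{n}{(n-m)/2}&\text{if } n-m\text{ is even},\\0&\text{otherwise.}\end{cases}$$
   Context: $R$ is the graph with vertex set $\mathbb{Z}$ and an undirected edge between $j$ and $j+1$ for every $j\in\mathbb{Z}$. A walk of length $n$ is a sequence $x_0,\dots,x_n$ of integers with $|x_i-x_{i-1}|=1$. A walk from $w_0$ coming successively through $w_1,\dots,w_{k-1}$ to $w_k$ is a walk with $x_0=w_0$, $x_n=w_k$ for which there exist indices $0\le i_1\le i_2\le\dots\le i_{k-1}\le n$ with $x_{i_j}=w_j$ for all $j$. $c_n(R,m)$ denotes the number of walks of length $n$ from $0$ to $m$. Convention: $\binom{n}{r}=0$ for $r<0$ or $r>n$. *)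

(* Defs.v *)
From mathcomp Require Import all_boot all_order all_algebra.
From mathcomp Require Import finmap zify.
From mathcomp Require Import boolp classical_sets functions cardinality.

Set Implicit Arguments.
Unset Strict Implicit.
Unset Printing Implicit Defensive.

Import Order.TTheory GRing.Theory Num.Theory.

Local Open Scope ring_scope.

(* The graph R with vertex set Z enters through its adjacency relation
   `|x - y| = 1. The vertices of a walk of length n are x`_0, ..., x`_n. *)
Definition is_walk (n : nat) (x : n.+1.-tuple int) : Prop :=
  forall i : nat, (i < n)%N -> `|x`_i.+1 - x`_i| = 1.

Definition walks (n : nat) (a b : int) : set (n.+1.-tuple int) :=
  [set x | is_walk x /\ x`_0 = a /\ x`_n = b]%classic.
Arguments walks n a b : clear implicits.

(* Only the values t 1, ..., t k.-1 of the index function t matter. *)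
Definition comes_through (n k : nat) (w : nat -> int) (x : n.+1.-tuple int) :
    Prop :=
  exists t : nat -> nat,
    (forall j : nat, (1 <= j < k)%N -> (t j <= n)%N /\ x`_(t j) = w j) /\
    (forall j : nat, (1 <= j)%N -> (j.+1 < k)%N -> (t j <= t j.+1)%N).

Definition walks_through (n k : nat) (w : nat -> int) :
    set (n.+1.-tuple int) :=
  [set x | walks n (w 0%N) (w k) x /\ comes_through k w x]%classic.
Arguments walks_through n k w : clear implicits.

(* fset_set returns the empty set on infinite sets; finite_walks and
   finite_walks_through below show that this default is never used here. *)
Definition nb_walks (n : nat) (m : int) : nat := #|` fset_set (walks n 0 m)|.

(* The j-th vertex to visit is the partial sum m_1 + ... + m_j, where m_1, ...,
   m_k are the entries ms`_0, ..., ms`_k.-1. *)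
Definition nb_walks_through (n k : nat) (ms : k.-tuple int) : nat :=
  #|` fset_set (walks_through n k (fun j => \sum_(i < j) ms`_i))|.

(* 'C(n, r) is already 0 for r > n. *)
Definition binz (n : nat) (r : int) : nat :=
  match r with
  | Posz r' => 'C(n, r')
  | Negz _ => 0%N
  end.

Lemma finite_walks (n : nat) (a b : int) : finite_set (walks n a b).
Proof.
pose f (s : {ffun 'I_n.+1 -> 'I_(n + n).+1}) : n.+1.-tuple int :=
  [tuple a + (s j : nat)%:Z - n%:Z | j < n.+1].
apply: (@sub_finite_set _ _ (f @` setT)%classic); last first.
  by apply: finite_image; exact: finite_finset.
move=> x [xw [x0 _]].
have xb (j : nat) : (j <= n)%N -> `|x`_j - a| <= j%:Z.
  elim: j => [|j IHj] ltjn; first by rewrite x0 subrr normr0.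
  by have := IHj (ltnW ltjn); have := xw j ltjn; lia.
exists [ffun j : 'I_n.+1 => inord (absz (x`_j - a + n%:Z))] => //.
apply: eq_from_tnth => j; rewrite tnth_mktuple ffunE (tnth_nth 0).
have lejn : (j <= n)%N by rewrite -ltnS.
have yb := xb j lejn; set y : int := x`_j in yb *.
by rewrite inordK; lia.
Qed.

Lemma finite_walks_through (n k : nat) (w : nat -> int) :
  finite_set (walks_through n k w).
Proof. by apply: sub_finite_set (finite_walks n (w 0%N) (w k)) => x []. Qed.

(* Main.v *)
(* Count the walks from a through the targets w_1, ..., w_p to b greedily:
   discard the leading targets equal to a, then take one step. If the itinerary
   a, w_1, ..., w_p, b has total length m.+1 after that, one of the two steps
   decreases it to m and the other increases it to m.+2; if it has length 0,
   both steps bring it to 1. The number of walks thus obeys a recursion on (n, m)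
   only, which the binomial coefficients satisfy as well. *)
Require Import Defs.
From mathcomp Require Import all_boot all_order all_algebra.
From mathcomp Require Import finmap zify.
From mathcomp Require Import classical_sets cardinality.

Set Implicit Arguments.
Unset Strict Implicit.
Unset Printing Implicit Defensive.

Import Order.TTheory GRing.Theory Num.Theory.

Local Open Scope ring_scope.

(** * Greedy matching of a walk against a list of targets *)

Fixpoint strip (T : eqType) (a : T) (ws : seq T) : seq T :=
  if ws is w :: ws' then if w == a then strip a ws' else ws else [::].

(* Greedy test that the sequence x meets the targets ws in this order; one entry
   of x may serve several consecutive equal targets. *)
Fixpoint visits (T : eqType) (ws x : seq T) : bool :=
  if x is a :: x' then visits (strip a ws) x' else nilp ws.

Lemma visits_nil (T : eqType) (x : seq T) : visits [::] x.
Proof. by elim: x. Qed.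

Lemma visits_behead (T : eqType) (w : T) (ws x : seq T) :
  visits (w :: ws) x -> visits ws x.
Proof.
elim: x w ws => [//|a x IHx] w ws /=; case: eqP => // _ /IHx.
elim: ws => //= u ws IHws vis; case: eqP => // _.
by apply: IHws; apply: IHx vis.
Qed.

Lemma visits_strip (T : eqType) (a : T) (ws x : seq T) :
  visits ws x -> visits (strip a ws) x.
Proof.
elim: ws => //= w ws IHws vis; case: eqP => // _.
by apply: IHws; apply: visits_behead vis.
Qed.

(** Greedy matching loses nothing: a target met anywhere may be met at its first admissible
    position. Index 0 matches a target that [strip] removes; positive indices shift down to the
    tail. *)
Lemma visitsP (T : eqType) (x0 : T) (ws x : seq T) :
  reflect (exists ts : seq nat,
    [/\ sorted leq ts, all (ltn^~ (size x)) ts & map (nth x0 x) ts = ws])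
  (visits ws x).
Proof.
apply: (iffP idP).
  elim: x ws => [|a x IHx] ws /=; first by move/nilP->; exists [::].
  elim: ws => [|w ws IHws] /=; first by exists [::].
  case: eqP => [-> /IHws [ts [st tb tw]]|_ /IHx [ts [st tb tw]]].
    exists (0%N :: ts) => /=; rewrite tb tw; split=> //.
    by rewrite path_min_sorted //; apply/allP.
  exists (map S ts); split; first by rewrite sorted_map.
  - by rewrite all_map.
  - by rewrite -map_comp.
case=> ts [st tb <-{ws}].
elim: x ts st tb => [|a x IHx] ts st tb; first by case: ts tb {st}.
elim: ts st tb => [|[|i] ts IHts] st tb; first exact: visits_nil.
  rewrite /= eqxx; apply: IHts; first exact: path_sorted st.
  by case/andP: tb.
have pos j : j \in i.+1 :: ts -> (0 < j)%N.
  rewrite inE => /predU1P[->//|jts].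
  have := order_path_min leq_trans st.
  by move/allP/(_ _ jts); apply: leq_trans.
have tsE : i.+1 :: ts = map S (map predn (i.+1 :: ts)).
  rewrite -map_comp -[LHS]map_id; apply/eq_in_map => j /pos /=.
  by case: j.
move: st tb; rewrite tsE; move: (map predn _) => ts' st tb.
(* No index points at [a] here, yet the greedy test may strip leading targets equal to [a]; having
   fewer targets left is harmless. *)
rewrite -map_comp; apply: visits_strip; apply: IHx.
  by move: st; rewrite sorted_map.
by move: tb; rewrite all_map.
Qed.

(** * Explicit enumeration of the walks *)

Fixpoint walk_enum (n : nat) (a : int) (ws : seq int) (b : int) :
    seq (seq int) :=
  if n is n'.+1 then
    map (cons a) (walk_enum n' (a + 1) (strip a ws) b ++
                  walk_enum n' (a - 1) (strip a ws) b)
  else if nilp (strip a ws) && (a == b) then [:: [:: a]] else [::].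

Definition step : rel int := fun u v => `|v - u| == 1.

Lemma mem_walk_enum (n : nat) (a : int) (ws : seq int) (b : int) (x : seq int) :
  (x \in walk_enum n a ws b) =
  [&& size x == n.+1, head 0 x == a, sorted step x, last 0 x == b
    & visits ws x].
Proof.
elim: n a ws x => [|n IHn] a ws x /=.
  case: x => [|c [|d x]] /=; rewrite ?andbF /=;
    try by case: ifP => _; rewrite ?inE ?eqseq_cons ?andbF.
  case: (eqVneq c a) => [->|ca] /=; last first.
    by case: ifP => _; rewrite // inE eqseq_cons (negPf ca).
  by rewrite andbC; case: ifP; rewrite // inE eqxx.
apply/idP/idP => [/mapP[y]|].
  rewrite mem_cat !IHn => yin ->.
  case: y yin => [|c y] //= yin; rewrite eqxx /=.
  have cs : step a c by rewrite /step; lia.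
  by rewrite cs; case/orP: yin => /and5P[/eqP[<-] _ -> -> ->]; rewrite eqxx.
case: x => [|a' x] //= /and5P[sx /eqP-> px lx vx].
apply/mapP; exists x => //.
rewrite mem_cat !IHn vx; case: x sx px lx {vx} => [|c x] //=.
by rewrite eqSS => -> /andP[ac ->] -> /=; move: ac; rewrite /step; lia.
Qed.

(** The two sublists are disjoint: their walks start at [a + 1] and [a - 1]. *)
Lemma walk_enum_uniq (n : nat) (a : int) (ws : seq int) (b : int) :
  uniq (walk_enum n a ws b).
Proof.
elim: n a ws => [|n IHn] a ws /=; first by case: ifP.
rewrite map_inj_uniq => [|u v []//]; rewrite cat_uniq !IHn andbT /=.
apply/hasPn => x; rewrite !mem_walk_enum => /and5P[_ /eqP-> _ _ _].
by apply/negP => /and5P[_ /eqP]; lia.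
Qed.

(** * Itinerary length and the binomial recursion *)

Fixpoint itinerary_length (a : int) (ws : seq int) (b : int) : nat :=
  if ws is w :: ws' then (`|w - a| + itinerary_length w ws' b)%N
  else `|b - a|%N.

Lemma itinerary_length_strip (a : int) (ws : seq int) (b : int) :
  itinerary_length a (strip a ws) b = itinerary_length a ws b.
Proof.
elim: ws => //= w ws IHws; case: eqP => //= ->.
by rewrite IHws subrr.
Qed.

Lemma strip_head (T : eqType) (a w : T) (ws ws' : seq T) :
  strip a ws = w :: ws' -> w != a.
Proof. by elim: ws => //= u ws IHws; case: eqP => // /eqP ua [<-]. Qed.

(** The closed form in natural numbers. The guard [m <= n] matters: truncated subtraction would
    otherwise give ['C(n, 0) = 1]. *)
Definition walk_number (n m : nat) : nat :=
  if (m <= n)%N && (odd n == odd m) then 'C(n, (n - m)./2) else 0%N.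

Lemma walk_numberS0 (n : nat) :
  walk_number n.+1 0 = (walk_number n 1 + walk_number n 1)%N.
Proof.
rewrite /walk_number /=.
case: (boolP (odd n)) => [on|] /=; last by rewrite andbF.
have n1 : (0 < n)%N by case: n on.
have -> : uphalf n = n./2.+1 by lia.
have -> : (n - 1)./2 = n./2 by lia.
rewrite n1 /= binS; congr (_ + _)%N.
(* With [n] odd, [n./2] and [n./2.+1] add up to [n], so both terms of Pascal's rule agree. *)
by rewrite -bin_sub; [congr 'C(_, _); lia | lia].
Qed.

Lemma walk_numberSS (n m : nat) :
  walk_number n.+1 m.+1 = (walk_number n m + walk_number n m.+2)%N.
Proof.
rewrite /walk_number ltnS subSS /= negbK eqb_negLR negbK.
case: (boolP (odd n == odd m)) => [/eqP onm|_]; last by rewrite !andbF.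
rewrite !andbT; have [ltmn|lenm] := ltnP m.+1 n.
  have -> : (m <= n)%N by lia.
  have -> : (n - m)./2 = (n - m.+2)./2.+1 by lia.
  by rewrite binS.
(* Now [m.+2 > n], so the second count is 0; equal parity leaves only [n = m] when [m <= n]. *)
rewrite addn0; case: leqP => // lemn.
have -> : n = m by lia.
by rewrite subnn !bin0.
Qed.

(** If a target remains after stripping, it differs from [a]; a step then changes the length of this
    first leg alone, by 1 either way. *)
Lemma size_walk_enum (n : nat) (a : int) (ws : seq int) (b : int) :
  size (walk_enum n a ws b) = walk_number n (itinerary_length a ws b).
Proof.
elim: n a ws => [|n IHn] a ws /=; rewrite -(itinerary_length_strip a ws);
  case sE : (strip a ws) => [|w ws'].
- rewrite /walk_number /= leqn0 absz_eq0 subr_eq0 (eq_sym a).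
  by case: eqP => //= ->; rewrite subrr.
- have := strip_head sE => wa.
  by rewrite /walk_number leqn0 /= ifN //; lia.
- rewrite size_map size_cat !IHn /=.
  have [->|ab] := eqVneq b a.
    rewrite subrr walk_numberS0.
    by congr (walk_number _ _ + walk_number _ _)%N; lia.
  case dE : `|b - a|%N => [|d]; first lia.
  rewrite walk_numberSS.
  (* The step towards [b] gives the shorter length; for [b] on the left the summands are
     exchanged. *)
  have [ltab|ltba] := ltP a b; last rewrite addnC;
  by congr (walk_number _ _ + walk_number _ _)%N; lia.
- have := strip_head sE => wa.
  rewrite size_map size_cat !IHn /=.
  case dE : `|w - a|%N => [|d]; first lia.
  rewrite addSn walk_numberSS.
  have [ltab|ltba] := ltP a w; last rewrite addnC;
  by congr (walk_number _ _ + walk_number _ _)%N; lia.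
Qed.

(** * From lists to cardinalities of sets of walks *)

Lemma card_fset_set_tuple (T : choiceType) (n : nat)
    (S : set (n.-tuple T)) (e : seq (seq T)) :
  uniq e -> {in e, forall x, size x = n} ->
  (forall x : n.-tuple T, S x <-> tval x \in e) ->
  #|` fset_set S| = size e.
Proof.
move=> ue se Se.
pose insub_tuple : seq T -> option (n.-tuple T) := insub.
(* Exhibiting [S] as a finite set keeps [fset_set] away from its default value. *)
have -> : S = [set` [fset x in pmap insub_tuple e]%fset]%classic.
  apply/seteqP; split=> x /=; rewrite inE mem_pmap_sub.
    by move/Se.
  by move=> xe; apply/Se.
rewrite set_fsetK card_fseq undup_id ?pmap_sub_uniq // size_pmap_sub.
(* All entries of [e] have length [n], so [pmap] drops none. *)
by apply/eqP; rewrite -all_count; apply/allP => x /se /eqP.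
Qed.

Lemma walksP (n : nat) (a b : int) (x : n.+1.-tuple int) :
  walks n a b x <-> [&& head 0 x == a, sorted step x & last 0 x == b].
Proof.
have lastE : last 0 x = x`_n by rewrite -nth_last size_tuple.
have walkE : is_walk x <-> sorted step x.
  split=> [xw|/(sortedP 0) xs i ltin]; last first.
    by apply/eqP; apply: xs; rewrite size_tuple.
  by apply/(sortedP 0) => i; rewrite size_tuple => lti; apply/eqP/xw.
rewrite lastE -nth0; split=> [[/walkE-> [-> ->]]|]; first by rewrite !eqxx.
by case/and3P => /eqP xa /walkE xw /eqP xb.
Qed.

Lemma comes_throughP (n k : nat) (w : nat -> int) (x : n.+1.-tuple int) :
  comes_through k w x <-> visits (map w (iota 1 k.-1)) x.
Proof.
split=> [[t [tw tm]]|/(visitsP 0) [ts [st tb tw]]].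
  apply/(visitsP 0); exists (map t (iota 1 k.-1)); split.
  - apply/(sortedP 0%N) => i; rewrite size_map size_iota => lti.
    rewrite !(nth_map 0%N) ?size_iota ?nth_iota; try lia.
    by rewrite addnS; apply: tm; lia.
  - rewrite all_map; apply/allP => j; rewrite mem_iota => jk /=.
    by rewrite size_tuple ltnS; have [|]// := tw j; lia.
  - rewrite -map_comp; apply/eq_in_map => j; rewrite mem_iota => jk.
    by have [|]// := tw j; lia.
have sts : size ts = k.-1 by have := congr1 size tw; rewrite !size_map size_iota.
(* Targets are numbered from 1 and list positions from 0, hence [j.-1]. *)
exists (fun j => nth 0%N ts j.-1); split=> [[//|j] jk|[//|j] _ jk] /=.
  have ltj : (j < size ts)%N by lia.
  split; first by have /allP/(_ _ (mem_nth 0%N ltj)) := tb; rewrite size_tuple.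
  have := congr1 (nth 0 ^~ j) tw; rewrite (nth_map 0%N) //.
  by rewrite (nth_map 0%N) ?size_iota -?sts // nth_iota -?sts // add1n.
by move/(sortedP 0%N): st; apply; lia.
Qed.

Lemma nb_walksE (n : nat) (m : int) : nb_walks n m = walk_number n `|m|.
Proof.
rewrite /nb_walks (card_fset_set_tuple (walk_enum_uniq n 0 [::] m)).
- by rewrite size_walk_enum /= subr0.
- by move=> x; rewrite mem_walk_enum => /andP[/eqP].
- move=> x; rewrite mem_walk_enum size_tuple eqxx visits_nil andbT.
  exact: walksP.
Qed.

Lemma card_walks_through (n k : nat) (w : nat -> int) :
  #|` fset_set (walks_through n k w)| =
  walk_number n (itinerary_length (w 0%N) (map w (iota 1 k.-1)) (w k)).
Proof.
rewrite -size_walk_enum; apply: card_fset_set_tuple.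
- exact: walk_enum_uniq.
- by move=> x; rewrite mem_walk_enum => /andP[/eqP].
- move=> x; rewrite mem_walk_enum size_tuple eqxx /=.
  split=> [[/walksP/and3P[-> -> ->] /comes_throughP->]//|].
  by case/and4P=> xa xs xb /comes_throughP xt; split=> //; apply/walksP/and3P.
Qed.

Lemma itinerary_length_map (w : nat -> int) (i p : nat) :
  itinerary_length (w i) (map w (iota i.+1 p)) (w (i + p).+1) =
  (\sum_(i <= j < (i + p).+1) `|w j.+1 - w j|)%N.
Proof.
elim: p i => [|p IHp] i /=; first by rewrite addn0 big_nat1.
by rewrite -addSnnS IHp [RHS]big_ltn //; lia.
Qed.

Theorem theorem25 (k : nat) (hk : (2 <= k)%N) (ms : k.-tuple int) (n : nat) :
  let m : int := \sum_(i < k) `|ms`_i| in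
  nb_walks_through n ms = nb_walks n m /\
  nb_walks n m =
    (if (2 %| n%:Z - m)%Z then binz n ((n%:Z - m) %/ 2)%Z else 0%N).
Proof.
move=> m.
have mE : m = (\sum_(i < k) `|(ms`_i)%R|)%N :> int.
  by rewrite /m -natz natr_sum; apply: eq_bigr => i _; rewrite natz abszE.
rewrite nb_walksE mE absz_nat; split.
  rewrite /nb_walks_through card_walks_through; congr walk_number.
  set w := fun j : nat => \sum_(i < j) ms`_i.
  have := itinerary_length_map w 0 k.-1; rewrite add0n prednK; last lia.
  move=> ->; rewrite big_mkord; apply: eq_bigr => i _.
  (* The targets are partial sums, so each leg is given by one entry of [ms]. *)
  by rewrite /w big_ord_recr /= addrC addKr.
move: (\sum_(i < k) _)%N => {mE m} m; rewrite /walk_number.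
have [lemn|ltnm] := leqP m n.
  rewrite subzn // dvdzE /= dvdn2 oddB // negb_add.
  by case: ifP => // _; rewrite mul1n divn2.
(* For [n < m] the quotient is negative, and [binz] sends it to 0. *)
case: ifP => // _; case dE : (_ %/ _)%Z => [d|//]; lia.
Qed.
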